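(* Let $m,n\geq k\geq2$ be integers, and let $A\in\mathbb{R}^{m\times n}$ with $A\leq0$ (all entries non-positive). For every $r\in[2,k]$ and every $r\times r$ submatrix $A_r$ of $A$, fix an arbitrary choice of $\alpha\in\mathbb{R}^r_{\mathrm{alt}}$ ($\alpha$ may depend on $A_r$), and define $x^{A_r}:=\operatorname{adj}(A_r)\alpha$. The following statements are equivalent: (1) The matrix $A$ is totally non-positive of order $k$. (2) Every square submatrix of $A$ of size $r\in[2,k]$ has the non-strict sign non-reversal property on $\mathbb{R}^r_{+,-}$. (3) Every square submatrix of $A$ of size $r\in[2,k]$ has the non-strict sign non-reversal property on $\mathbb{R}^r_{\mathrm{alt}}$. (4) For every $r\in[2,k]$ and every $r\times r$ submatrix $A_r$ of $A$, the matrix $A_r$ has the non-strict sign non-reversal property for the vector $x^{A_r}$ (i.e. on the set $\{x^{A_r}\}$).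
   Context: A real matrix is totally non-positive of order $k$ if all its minors of order at most $k$ are non-positive. $\operatorname{adj}$ denotes the adjugate matrix; $[a,b]$ is the set of integers from $a$ to $b$. $\mathbb{R}^r_{+,-}$ is the set of vectors in $\mathbb{R}^r$ with at least one positive and at least one negative coordinate. $\mathbb{R}^r_{\mathrm{alt}}$ is the set of vectors in $\mathbb{R}^r$ whose coordinates are all nonzero and have alternating signs. A matrix $B\in\mathbb{R}^{r\times r}$ has the non-strict sign non-reversal property on a set $T\subseteq\mathbb{R}^r$ if for every $0\neq x\in T$ there exists $i\in[1,r]$ such that $x_i\neq0$ and $x_i(Bx)_i\geq0$. *)

(* Defs.v *)
From mathcomp Require Import all_boot all_order all_algebra.
From mathcomp Require Import classical_sets reals.

Set Implicit Arguments.
Unset Strict Implicit.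
Unset Printing Implicit Defensive.

Import Order.TTheory GRing.Theory Num.Theory.
Local Open Scope ring_scope.
Local Open Scope classical_set_scope.

(* The r x r submatrices of A : 'M_(m, n) are the mxsub f g A where f and g
   are strictly increasing; finfuns make f and g unique for given row and
   column index sets. *)
Definition strictly_increasing (r m : nat) (f : {ffun 'I_r -> 'I_m}) : Prop :=
  forall i j : 'I_r, (i < j)%N -> (f i < f j)%N.

(* The bound 0 < r excludes the empty minor, which is 1. *)
Definition totally_nonpositive (R : realType) (m n : nat) (k : nat)
    (A : 'M[R]_(m, n)) : Prop :=
  forall (r : nat) (f : {ffun 'I_r -> 'I_m}) (g : {ffun 'I_r -> 'I_n}),
    (0 < r <= k)%N -> strictly_increasing f -> strictly_increasing g ->
    \det (mxsub f g A) <= 0.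

Definition mixed_sign (R : realType) (r : nat) : set 'cV[R]_r :=
  [set x | (exists i, 0 < x i 0) /\ (exists i, x i 0 < 0)].

Definition alternating (R : realType) (r : nat) : set 'cV[R]_r :=
  [set x | (forall i, x i 0 != 0) /\
           (forall i j : 'I_r, j = i.+1 :> nat -> x i 0 * x j 0 < 0)].

Definition sign_nonreversal (R : realType) (r : nat) (B : 'M[R]_r)
    (T : set 'cV[R]_r) : Prop :=
  forall x : 'cV[R]_r, T x -> x != 0 ->
    exists i : 'I_r, x i 0 != 0 /\ 0 <= x i 0 * (B *m x) i 0.

(* Main.v *)
Require Import Defs.
From mathcomp Require Import all_boot all_order all_algebra all_fingroup.
From mathcomp Require Import zify ring.
From mathcomp Require Import classical_sets reals.

(** Two sign patterns drive everything.

    The adjugate pattern. If all minors of order r - 1 of an r x r matrix B are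
    non-positive and alpha alternates, then in
    (adj B alpha)_i = \sum_j (-1)^(i+j) M_ji alpha_j all terms have the sign
    opposite to alpha_i ([adj_alternating_le0]). As B (adj B) = (det B) I, the
    product x_i (B x)_i for x = adj B alpha is det B times the non-positive
    number alpha_i x_i. So a non-positive determinant gives sign non-reversal
    at x; conversely, if det B is nonzero then x alternates strictly, and
    non-reversal at x forces det B <= 0. Induction on the order of the minors
    ([totally_nonpositive_of_adj]) then yields total non-positivity from
    non-reversal on all alternating vectors, or at the chosen vectors alone.

    Variation of signs. Let B be totally non-positive and suppose that x, of
    mixed sign, is reversed: x_i (B x)_i < 0 whenever x_i is nonzero. Cut the
    coordinates of x into p >= 2 maximal runs of constant sign, add up the
    columns of each run with weights |x_j|, and keep one row per run. Minors of
    the matrix D so obtained are non-negative combinations of minors of B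
    ([totally_nonpositive_mul]), and D reverses the vector e of alternating
    signs; in particular D e alternates.
    - If D is invertible, the adjugate pattern applied to alpha = D e, where
      adj D (D e) = (det D) e, gives det D > 0, which is absurd.
    - If D is singular, D e cannot alternate ([image_not_alternating]). Take the
      first row that depends on the earlier ones, say row number c, and c
      columns in which those earlier rows are independent. The border of these
      c columns by D e, on the rows up to c, has determinant zero; but in its
      expansion along D e all terms have the same weak sign, and the last one
      is nonzero. *)

Set Implicit Arguments.
Unset Strict Implicit.
Unset Printing Implicit Defensive.

Import Order.TTheory GRing.Theory Num.Theory.
Local Open Scope ring_scope.
Local Open Scope classical_set_scope.

(** * Alternating vectors *)

(** A form of alternation that compares arbitrary, not only consecutive,
    coordinates: up to a global sign, x_i has the sign (-1)^i. *)
Lemma alternating_mul_gt0 (R : realType) (r : nat) (x : 'cV[R]_r) :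
  alternating x -> forall i j : 'I_r, 0 < (-1) ^+ (i + j) * (x i 0 * x j 0).
Proof.
move=> [x_neq0 x_alt].
have shift d (i j : 'I_r) : j = (i + d)%N :> nat ->
    0 < (-1) ^+ d * (x i 0 * x j 0).
  elim: d j => [|d IHd] j jE.
    have -> : j = i by apply: val_inj; rewrite /= jE addn0.
    by rewrite expr0 mul1r -expr2 exprn_even_gt0 /=.
  have ltd : (i + d < r)%N by have := ltn_ord j; lia.
  have := IHd (Ordinal ltd) erefl.
  have := x_alt (Ordinal ltd) j; rewrite /= jE addnS => /(_ erefl).
  move: (x_neq0 (Ordinal ltd)); set y := x (Ordinal ltd) 0 => y_neq0.
  rewrite exprS => lt0 gt0.
  have y2 : 0 < y ^+ 2 by rewrite exprn_even_gt0 /=.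
  (* Chain the signs of the pairs (i, y) and (y, j): y occurs squared. *)
  rewrite -(pmulr_rgt0 _ y2).
  have -> : y ^+ 2 * (-1 * (-1) ^+ d * (x i 0 * x j 0)) =
    ((-1) ^+ d * (x i 0 * y)) * - (y * x j 0) by ring.
  by rewrite mulr_gt0 // oppr_gt0.
have sgnD (i d : nat) : (-1) ^+ (i + (i + d)) = (-1) ^+ d :> R.
  by rewrite addnA exprD addnn -mul2n exprM sqrrN expr1n expr1n mul1r.
move=> i j; case: (leqP i j) => [le_ij|/ltnW le_ji].
  by rewrite -(subnKC le_ij) sgnD shift // subnKC.
rewrite addnC [x i 0 * _]mulrC -(subnKC le_ji) sgnD shift //.
by rewrite subnKC.
Qed.

Lemma alternatingI (R : realType) (r : nat) (x : 'cV[R]_r) :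
  (forall i j : 'I_r, 0 < (-1) ^+ (i + j) * (x i 0 * x j 0)) -> alternating x.
Proof.
move=> x_sgn; split=> [i|i j jE].
  by have := x_sgn i i; apply: contraTneq => ->; rewrite mul0r mulr0 ltxx.
have := x_sgn i j; rewrite jE addnS exprS addnn -mul2n exprM sqrrN.
by rewrite !expr1n mulr1 mulN1r oppr_gt0.
Qed.

Lemma alternating_reversed (R : realType) (r : nat) (x y : 'cV[R]_r) :
  alternating x -> (forall i, x i 0 * y i 0 < 0) -> alternating y.
Proof.
move=> x_alt xy_lt0.
apply: alternatingI => i j; have x_sgn := alternating_mul_gt0 x_alt i j.
rewrite -(pmulr_rgt0 _ x_sgn).
have -> : (-1) ^+ (i + j) * (x i 0 * x j 0) *
    ((-1) ^+ (i + j) * (y i 0 * y j 0)) =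
    ((-1) ^+ (i + j)) ^+ 2 * ((x i 0 * y i 0) * (x j 0 * y j 0)) by ring.
by rewrite sqrr_sign mul1r nmulr_lgt0.
Qed.

Lemma alternating_neq0 (R : realType) (r : nat) (x : 'cV[R]_r) :
  (0 < r)%N -> alternating x -> x != 0.
Proof.
case: r x => // r x _ [x_neq0 _]; apply: contra_neq (x_neq0 ord0) => ->.
by rewrite mxE.
Qed.

Lemma alternating_mixed_sign (R : realType) (r : nat) (x : 'cV[R]_r) :
  (2 <= r)%N -> alternating x -> mixed_sign x.
Proof.
case: r x => [|[|r]] // x _ [x_neq0 x_alt].
pose i1 : 'I_r.+2 := lift ord0 ord0.
have := x_alt ord0 i1 erefl; have := x_neq0 ord0.
rewrite neq_lt => /orP[x0|x0].
  by rewrite nmulr_rlt0 // => x1; split; [exists i1|exists ord0].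
by rewrite pmulr_rlt0 // => x1; split; [exists ord0|exists i1].
Qed.

(** * Totally non-positive matrices *)

Lemma strictly_increasing_lift (r : nat) (i : 'I_r.+1) :
  strictly_increasing [ffun j => lift i j].
Proof. by move=> j j'; rewrite !ffunE /= /bump; lia. Qed.

Lemma totally_nonpositive_mxsub (R : realType) (m n p q k : nat)
    (f : {ffun 'I_p -> 'I_m}) (g : {ffun 'I_q -> 'I_n}) (A : 'M[R]_(m, n)) :
  strictly_increasing f -> strictly_increasing g ->
  totally_nonpositive k A -> totally_nonpositive k (mxsub f g A).
Proof.
move=> f_incr g_incr A_le0 r f' g' r_bnd f'_incr g'_incr.
rewrite -mxsub_comp -mxsub_ffun; apply: A_le0 => // i j lt_ij; rewrite !ffunE.
  by apply: f_incr; apply: f'_incr.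
by apply: g_incr; apply: g'_incr.
Qed.

Lemma totally_nonpositive_le (R : realType) (m n k l : nat)
    (A : 'M[R]_(m, n)) :
  (l <= k)%N -> totally_nonpositive k A -> totally_nonpositive l A.
Proof.
move=> le_lk A_le0 r f g /andP[r_gt0 r_le]; apply: A_le0.
by rewrite r_gt0 (leq_trans r_le).
Qed.

Lemma totally_nonpositive_det (R : realType) (r k : nat) (B : 'M[R]_r) :
  (0 < r <= k)%N -> totally_nonpositive k B -> \det B <= 0.
Proof.
move=> r_bnd B_le0; have := B_le0 r [ffun i => i] [ffun i => i] r_bnd.
by rewrite mxsub_ffun mxsub_id; apply=> i j; rewrite !ffunE.
Qed.

Lemma cofactor_minor_le0 (R : realType) (r k : nat) (B : 'M[R]_r) :
  (2 <= r)%N -> (r <= k.+1)%N -> totally_nonpositive k B ->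
  forall i j, \det (row' i (col' j B)) <= 0.
Proof.
case: r B => // r B r_ge2 r_le B_le0 i j.
have -> : row' i (col' j B) =
    mxsub [ffun i' => lift i i'] [ffun j' => lift j j'] B.
  by apply/matrixP => a b; rewrite !mxE !ffunE.
by apply: B_le0; try exact: strictly_increasing_lift; lia.
Qed.

(** * The adjugate applied to an alternating vector *)

(** Multiplying the i-th coordinate of adj B alpha by alpha_i turns it into the
    sum over j of the minors M_ji with the positive weights
    (-1)^(j+i) alpha_j alpha_i, so there is no cancellation: the sum vanishes
    only if every minor in it does. *)
Lemma adj_alternating_le0 (R : realType) (r : nat) (B : 'M[R]_r)
    (alpha : 'cV[R]_r) :
  (forall i j, \det (row' i (col' j B)) <= 0) -> alternating alpha ->
  forall i, alpha i 0 * (\adj B *m alpha) i 0 <= 0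
    ?= iff (\row_j \adj B i j == 0).
Proof.
move=> B_le0 alpha_alt i; have alpha_sgn := alternating_mul_gt0 alpha_alt.
have -> : alpha i 0 * (\adj B *m alpha) i 0 =
    \sum_(j < r) ((-1) ^+ (j + i) * (alpha j 0 * alpha i 0)) *
      \det (row' j (col' i B)).
  rewrite !mxE big_distrr; apply: eq_bigr => j _.
  by rewrite /= !mxE /cofactor; ring.
have t_le0 (j : 'I_r) : ((-1) ^+ (j + i) * (alpha j 0 * alpha i 0)) *
      \det (row' j (col' i B)) <= 0 by rewrite pmulr_rle0.
split; first exact: sumr_le0.
apply/eqP/eqP => [sum0|/rowP adj0]; last first.
  apply: big1 => j _; have := adj0 j; rewrite !mxE /cofactor => /eqP.
  by rewrite mulf_eq0 signr_eq0 /= => /eqP ->; rewrite mulr0.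
apply/rowP => j; rewrite !mxE /cofactor.
have /eqP : - (((-1) ^+ (j + i) * (alpha j 0 * alpha i 0)) *
    \det (row' j (col' i B))) = 0.
  pose u (j : 'I_r) := - (((-1) ^+ (j + i) * (alpha j 0 * alpha i 0)) *
    \det (row' j (col' i B))).
  apply: (psumr_eq0P (F := u) (P := xpredT)) => // [l _|].
    by rewrite /u oppr_ge0.
  by rewrite sumrN sum0 oppr0.
by rewrite oppr_eq0 mulf_eq0 gt_eqF //= => /eqP ->; rewrite mulr0.
Qed.

(** The adjugate of an invertible matrix has no zero row. *)
Lemma adj_alternating_lt0 (R : realType) (r : nat) (B : 'M[R]_r)
    (alpha : 'cV[R]_r) :
  (forall i j, \det (row' i (col' j B)) <= 0) -> alternating alpha ->
  \det B != 0 -> forall i, alpha i 0 * (\adj B *m alpha) i 0 < 0.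
Proof.
move=> B_le0 alpha_alt detB i.
rewrite (lt_leif (adj_alternating_le0 B_le0 alpha_alt i)).
apply: contra detB => /eqP/rowP adj0.
have /matrixP/(_ i i) := mul_adj_mx B; rewrite !mxE eqxx mulr1n => <-.
by rewrite big1 // => j _; have := adj0 j; rewrite !mxE => ->; rewrite mul0r.
Qed.

Lemma sign_nonreversal_adj (R : realType) (r : nat) (B : 'M[R]_r)
    (alpha : 'cV[R]_r) :
  (forall i j, \det (row' i (col' j B)) <= 0) -> alternating alpha ->
  \det B <= 0 -> \adj B *m alpha != 0 ->
  exists i, (\adj B *m alpha) i 0 != 0 /\
    0 <= (\adj B *m alpha) i 0 * (B *m (\adj B *m alpha)) i 0.
Proof.
move=> minor_le0 alpha_alt detB x_neq0.
have /cV0Pn[i xi] := x_neq0; exists i; split=> //.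
rewrite mulmxA mul_mx_adj mul_scalar_mx [fun_of_matrix (_ *: _) _ _]mxE.
rewrite mulrCA [X in _ * X]mulrC.
by rewrite mulr_le0 // (adj_alternating_le0 minor_le0 alpha_alt i).1.
Qed.

(** For det B nonzero, x = adj B alpha is reversed relative to alpha in every
    coordinate, hence alternates; since B x = (det B) alpha, each product
    x_i (B x)_i has the sign of - det B. *)
Lemma det_le0_of_nonreversal (R : realType) (r : nat) (B : 'M[R]_r)
    (alpha : 'cV[R]_r) :
  (0 < r)%N ->
  (forall i j, \det (row' i (col' j B)) <= 0) -> alternating alpha ->
  (alternating (\adj B *m alpha) -> \adj B *m alpha != 0 ->
   exists i, (\adj B *m alpha) i 0 != 0 /\
     0 <= (\adj B *m alpha) i 0 * (B *m (\adj B *m alpha)) i 0) ->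
  \det B <= 0.
Proof.
move=> r_gt0 minor_le0 alpha_alt nonrev.
have [->//|detB] := eqVneq (\det B) 0.
have x_rev := adj_alternating_lt0 minor_le0 alpha_alt detB.
have x_alt := alternating_reversed alpha_alt x_rev.
have [i [_]] := nonrev x_alt (alternating_neq0 r_gt0 x_alt).
rewrite mulmxA mul_mx_adj mul_scalar_mx [fun_of_matrix (_ *: _) _ _]mxE mulrCA.
by rewrite nmulr_lge0 // mulrC.
Qed.

(** Induction on the order of the minors. Non-reversal is required only when
    x = adj B alpha alternates, so that the criterion covers both non-reversal
    on all alternating vectors and non-reversal at the given x. *)
Lemma totally_nonpositive_of_adj (R : realType) (m n k : nat)
    (A : 'M[R]_(m, n))
    (alpha : forall r : nat,
      {ffun 'I_r -> 'I_m} -> {ffun 'I_r -> 'I_n} -> 'cV[R]_r) :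
  (forall i j, A i j <= 0) ->
  (forall (r : nat) (f : {ffun 'I_r -> 'I_m}) (g : {ffun 'I_r -> 'I_n}),
    (2 <= r <= k)%N -> strictly_increasing f -> strictly_increasing g ->
    alternating (alpha r f g)) ->
  (forall (r : nat) (f : {ffun 'I_r -> 'I_m}) (g : {ffun 'I_r -> 'I_n}),
    (2 <= r <= k)%N -> strictly_increasing f -> strictly_increasing g ->
    let x := \adj (mxsub f g A) *m alpha r f g in
    alternating x -> x != 0 ->
    exists i, x i 0 != 0 /\ 0 <= x i 0 * (mxsub f g A *m x) i 0) ->
  totally_nonpositive k A.
Proof.
move=> A_le0 alpha_alt nonrev.
elim: k alpha_alt nonrev => [|k IHk] alpha_alt nonrev.
  by move=> r f g /andP[r_gt0]; rewrite leqNgt r_gt0.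
have {IHk} Ak_le0 : totally_nonpositive k A.
  apply: IHk => r f g /andP[r_ge2 r_le]; [apply: alpha_alt|apply: nonrev];
    by rewrite r_ge2 leqW.
move=> r f g /andP[r_gt0 r_le] f_incr g_incr.
case: (ltngtP r 1) => [|r_ge2|r1]; first by rewrite ltnNge r_gt0.
  have r_bnd : (2 <= r <= k.+1)%N by rewrite r_ge2.
  apply: (det_le0_of_nonreversal r_gt0 _ (alpha_alt r f g _ _ _)) => //.
    apply: cofactor_minor_le0 r_ge2 r_le _.
    exact: totally_nonpositive_mxsub.
  exact: nonrev.
by subst r; rewrite det_mx11 mxE.
Qed.

(** * Alternating vectors in the image of a totally non-positive matrix *)

Lemma sort_injective (p q : nat) (g : 'I_p -> 'I_q) : injective g ->
  exists s : 'S_p, strictly_increasing [ffun i => g (s i)].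
Proof.
move=> g_inj.
have card_g : #|codom g| = p by rewrite card_codom // card_ord.
pose e (i : 'I_p) := Order.enum_val (cast_ord (esym card_g) i).
have eP i : e i \in codom g by apply: Order.EnumVal.enum_valP.
have s_inj : injective (fun i => iinv (eP i)).
  move=> i j /(congr1 g); rewrite !f_iinv => /Order.EnumVal.enum_val_inj.
  by apply: cast_ord_inj.
exists (perm s_inj) => i j lt_ij; rewrite !ffunE !permE !f_iinv.
rewrite ltnNge; have := Order.le_enum_val (@le_total _ _)
  (cast_ord (esym card_g) j) (cast_ord (esym card_g) i).
by rewrite !leEord /= => ->; rewrite -ltnNge.
Qed.

(** [fullrankfun] picks the columns of a nonsingular minor in no particular
    order; sorting them only changes the sign of the minor. *)
Lemma row_free_minor (F : fieldType) (p q : nat) (U : 'M[F]_(p, q)) :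
  row_free U -> exists2 g : {ffun 'I_p -> 'I_q},
    strictly_increasing g & \det (colsub g U) != 0.
Proof.
move=> freeU; have fullU : row_full U^T by rewrite /row_full mxrank_tr.
have [s s_incr] := sort_injective (@fullrankfun_inj _ _ _ _ fullU).
exists [ffun i => fullrankfun fullU (s i)] => //.
have -> : colsub [ffun i => fullrankfun fullU (s i)] U =
    col_perm s (rowsub (fullrankfun fullU) U^T)^T.
  by apply/matrixP=> i j; rewrite !mxE ffunE.
rewrite col_permE det_mulmx mulf_eq0 negb_or det_tr det_perm signr_eq0 andbT.
rewrite -unitfE -unitmxE; exact: fullrowsub_unit.
Qed.

(** The induction on p looks for the first row that depends on the earlier
    ones: as long as the matrix without its last row still has dependent rows,
    the last row can be dropped, because a prefix of an alternating vector
    alternates. *)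
Lemma image_not_alternating (R : realType) (k p q : nat) (D : 'M[R]_(p, q))
    (v : 'cV[R]_q) :
  (p <= k)%N -> totally_nonpositive k D -> ~~ row_free D ->
  ~ alternating (D *m v).
Proof.
elim: p D => [|p IHp] D le_pk D_le0 D_dep Dv_alt.
  by move: D_dep; rewrite /row_free flatmx0 mxrank0.
pose D' := rowsub [ffun i => lift ord_max i] D.
have [D'_free|D'_dep] := boolP (row_free D'); last first.
  apply: (IHp D') => //; first exact: ltnW.
    have := @totally_nonpositive_mxsub R _ _ _ _ k [ffun i => lift ord_max i]
      [ffun i => i] D (@strictly_increasing_lift _ ord_max).
    rewrite mxsub_eq_rowsub; last by move=> i; rewrite ffunE.
    by apply=> // i j; rewrite !ffunE.
  have [Dv_neq0 Dv_sgn] := Dv_alt.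
  rewrite /D' mul_rowsub_mx; split=> [i|i j jE]; rewrite !mxE !ffunE.
    by have := Dv_neq0 (lift ord_max i); rewrite mxE.
  by have := Dv_sgn (lift ord_max i) (lift ord_max j); rewrite !mxE !lift_max;
    apply.
have [g g_incr g_neq0] := row_free_minor D'_free.
pose d i := \det (mxsub [ffun j => lift i j] g D).
have d_max : d ord_max != 0.
  suff -> : d ord_max = \det (colsub g D') by [].
  by congr (\det _); apply/matrixP => i j; rewrite !mxE.
have d_sgn i j : 0 <= d i * d j.
  (* For p = 0 both minors are empty, hence equal to 1. *)
  case: (posnP p) => [p0|p_gt0].
    have det0 n (M : 'M[R]_n) : n = 0%N -> \det M = 1.
      by move=> n0; subst n; rewrite det_mx00.
    by rewrite /d !det0 // mul1r.
  by rewrite mulr_le0 // D_le0 //; try exact: strictly_increasing_lift; lia.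
(* D *m N is the submatrix of D on the columns g, bordered by D *m v. *)
pose N : 'M[R]_(q, p.+1) := \matrix_(i, j)
  if unlift ord_max j is Some j' then (i == g j')%:R else v i 0.
have detDN : \det (D *m N) = 0.
  apply/eqP; apply: contraNT D_dep; rewrite -unitfE -unitmxE -row_free_unit.
  rewrite /row_free => /eqP rkDN.
  rewrite eqn_leq rank_leq_row -[X in (X <= _)%N]rkDN.
  exact: mxrankM_maxl.
have detE : \sum_(i < p.+1) (-1) ^+ (i + p) * ((D *m v) i 0) * d i = 0.
  rewrite -[RHS]detDN (expand_det_col _ ord_max); apply: eq_bigr => i _.
  rewrite /cofactor /= -mulrA mulrCA; congr (_ * _); last congr (_ * \det _).
  - by rewrite !mxE; apply: eq_bigr => j _; rewrite mxE unlift_none.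
  apply/matrixP => a b; rewrite !mxE ffunE.
  rewrite (bigD1 (g b)) //= big1 => [|j j_neq]; rewrite !mxE liftK.
    by rewrite eqxx mulr1 addr0.
  by rewrite (negbTE j_neq) mulr0.
have z_sgn := alternating_mul_gt0 Dv_alt.
(* Multiplying the expansion by its own last term makes all terms
   non-negative, whatever the global signs are. *)
pose t (i : 'I_p.+1) := (-1) ^+ (i + p) * ((D *m v) i 0 * (D *m v) ord_max 0) *
  (d i * d ord_max).
have t_ge0 i : 0 <= t i.
  by rewrite /t mulr_ge0 // ltW //; apply: (z_sgn i ord_max).
have t_sum : \sum_i t i = 0.
  transitivity ((\sum_(i < p.+1) (-1) ^+ (i + p) * ((D *m v) i 0) * d i) *
    ((D *m v) ord_max 0 * d ord_max)); last by rewrite detE mul0r.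
  by rewrite big_distrl; apply: eq_bigr => i _; rewrite /t /=; ring.
have : t ord_max = 0 by apply: (psumr_eq0P _ t_sum) => // i _.
apply/eqP; rewrite /t !mulf_eq0 (negbTE d_max) !orbF -!mulf_eq0.
exact: lt0r_neq0 (z_sgn ord_max ord_max).
Qed.

(** The condition p >= 2 matters: the 1 x 1 matrix with entry -1 reverses
    every vector. It guarantees that the minors of order p - 1 which make up
    the adjugate are not the empty minor 1. *)
Lemma no_alternating_reversal (R : realType) (p : nat) (D : 'M[R]_p)
    (e : 'cV[R]_p) :
  (2 <= p)%N -> totally_nonpositive p D -> alternating e ->
  ~ (forall a, e a 0 * (D *m e) a 0 < 0).
Proof.
move=> p_ge2 D_le0 e_alt De_rev.
have z_alt := alternating_reversed e_alt De_rev.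
have [D_free|D_dep] := boolP (row_free D); last first.
  exact: (image_not_alternating (leqnn p) D_le0 D_dep z_alt).
have detD : \det D != 0 by rewrite -unitfE -unitmxE -row_free_unit.
have i0 : 'I_p by exists 0%N; lia.
have minor_le0 := cofactor_minor_le0 p_ge2 (leqnSn p) D_le0.
have := adj_alternating_lt0 minor_le0 z_alt detD i0.
rewrite mulmxA mul_adj_mx mul_scalar_mx [fun_of_matrix (_ *: _) _ _]mxE mulrCA.
have detD_lt0 : \det D < 0.
  rewrite lt_neqAle detD (@totally_nonpositive_det _ _ p) // leqnn andbT.
  exact: ltnW.
by rewrite nmulr_rlt0 // mulrC ltNge ltW.
Qed.

(** * Merging columns *)

(** The unsorted Cauchy-Binet formula: expanding the columns of the product by
    multilinearity, without grouping the choice functions phi by their image. *)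
Lemma det_mulmx_expand (R : comNzRingType) (r n : nat)
    (M : 'M[R]_(r, n)) (N : 'M[R]_(n, r)) :
  \det (M *m N) =
  \sum_(phi : {ffun 'I_r -> 'I_n}) (\prod_a N (phi a) a) * \det (colsub phi M).
Proof.
pose T s (phi : {ffun 'I_r -> 'I_n}) a := N (phi a) a * M (s a) (phi a).
transitivity (\sum_(s : 'S_r) \sum_phi (-1) ^+ s * \prod_a T s phi a).
  rewrite -det_tr; apply: eq_bigr => s _; rewrite -big_distrr /=.
  congr (_ * _); rewrite -(bigA_distr_bigA (fun a j => N j a * M (s a) j)) /=.
  by apply: eq_bigr => a _; rewrite !mxE; apply: eq_bigr => j _; rewrite mulrC.
rewrite exchange_big; apply: eq_bigr => phi _ /=.
rewrite -[in RHS]det_tr [in RHS]/determinant big_distrr /=.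
apply: eq_bigr => s _; rewrite /T big_split /= mulrCA; congr (_ * (_ * _)).
by apply: eq_bigr => a _; rewrite !mxE.
Qed.

(** Column a of B *m W combines the columns of B in the support of column a of
    W. As these supports are ordered like the columns, each choice function of
    nonzero weight in the expansion of a minor is strictly increasing, so it
    contributes a genuine minor of B. *)
Lemma totally_nonpositive_mul (R : realType) (m n p k : nat)
    (B : 'M[R]_(m, n)) (W : 'M[R]_(n, p)) :
  (forall j a, 0 <= W j a) ->
  (forall i j (a b : 'I_p), (a < b)%N ->
    W i a != 0 -> W j b != 0 -> (i < j)%N) ->
  totally_nonpositive k B -> totally_nonpositive k (B *m W).
Proof.
move=> W_ge0 W_incr B_le0 r f g r_bnd f_incr g_incr.
have -> : mxsub f g (B *m W) = rowsub f B *m colsub g W by rewrite mxsub_mul.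
rewrite det_mulmx_expand; apply: sumr_le0 => phi _.
have [w0|w_neq0] := eqVneq (\prod_a colsub g W (phi a) a) 0.
  by rewrite w0 mul0r.
have {}w_neq0 a : W (phi a) (g a) != 0.
  by move/prodf_neq0: w_neq0 => /(_ a isT); rewrite mxE.
rewrite mulr_ge0_le0 ?prodr_ge0 => // [a _|]; first by rewrite mxE.
have -> : colsub phi (rowsub f B) = mxsub f phi B.
  by apply/matrixP => i j; rewrite !mxE.
apply: B_le0 => // i j lt_ij.
exact: W_incr (g_incr _ _ lt_ij) (w_neq0 i) (w_neq0 j).
Qed.

(** * Runs of constant sign *)

(** The maximal runs of constant sign among the nonzero values x 0, ...,
    x (n - 1): rho j is the index of the run of j, p the number of runs, and
    the run of index a has sign (-1)^(s + a). At zeros of x the value of rho is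
    irrelevant, as |x j| = 0 there. Stated on nat so that the induction
    appends one value at a time. *)
Lemma nat_sign_runs (R : realType) (x : nat -> R) (n : nat) :
  exists (s p : nat) (rho : nat -> nat),
  [/\ forall j, (j < n)%N -> x j != 0 -> (rho j < p)%N,
      forall i j, (i <= j < n)%N -> x i != 0 -> x j != 0 -> (rho i <= rho j)%N,
      forall a, (a < p)%N -> exists2 i, (i < n)%N & x i != 0 /\ rho i = a &
      forall j, (j < n)%N -> x j = (-1) ^+ (s + rho j) * `|x j|].
Proof.
elim: n => [|n [s [p [rho [rho_lt rho_mono rho_onto rho_sgn]]]]].
  by exists 0%N, 0%N, (fun=> 0%N); split=> // i j /andP[].
have [xn0|xn_neq0] := eqVneq (x n) 0.
  exists s, p, rho; split.
  - move=> j; rewrite ltnS leq_eqVlt => /predU1P[->|]; last exact: rho_lt.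
    by rewrite xn0 eqxx.
  - move=> i j /andP[le_ij]; rewrite ltnS leq_eqVlt => /predU1P[->|lt_jn].
      by rewrite xn0 eqxx.
    by apply: rho_mono; rewrite le_ij.
  - by move=> a /rho_onto[i lt_in xi]; exists i => //; exact: leqW.
  - move=> j; rewrite ltnS leq_eqVlt => /predU1P[->|]; last exact: rho_sgn.
    by rewrite xn0 normr0 mulr0.
(* q is the run of the index n: a new run if there is none yet or the sign
   changes, and the last existing run otherwise. Only in the first run can the
   global sign s still be chosen. *)
have [s' [q [xn_sgn s'E qE]]] : exists (s' q : nat),
    [/\ x n = (-1) ^+ (s' + q) * `|x n|, (0 < p)%N -> s' = s &
        q = p \/ q.+1 = p].
  have [t xnE] : exists t : nat, x n = (-1) ^+ t * `|x n|.
    by exists (x n < 0)%R; exact: realEsign (num_real _).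
  case: (posnP p) => [->|p_gt0].
    by exists t, 0%N; rewrite addn0; split=> //; left.
  have [par|par] := boolP (odd t == odd (s + p)).
    exists s, p; split=> //; last by left.
    by rewrite -signr_odd -(eqP par) signr_odd.
  exists s, p.-1; split=> //; last by right; rewrite prednK.
  rewrite [LHS]xnE -signr_odd -[in RHS]signr_odd; congr ((-1) ^+ _ * _).
  by move: par; rewrite -(prednK p_gt0) addnS /=; case: (odd t); case: (odd _).
exists s', q.+1, (fun j => if j == n then q else rho j); split.
- move=> j; rewrite ltnS leq_eqVlt; case: eqP => //= _ lt_jn xj.
  by have := rho_lt j lt_jn xj; lia.
- move=> i j /andP[le_ij]; rewrite ltnS leq_eqVlt.
  case: (eqVneq j n) => [jE|_] /= lt_jn xi xj.
    case: eqVneq => // i_neq; have lt_in : (i < n)%N by lia.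
    by have := rho_lt i lt_in xi; lia.
  by case: eqVneq => [iE|_]; [lia|apply: rho_mono => //; rewrite le_ij].
- move=> a lt_aq; have [->|a_neq] := eqVneq a q.
    by exists n => //; rewrite eqxx.
  have [|i lt_in xi] := rho_onto a; first by lia.
  by exists i; [exact: leqW|rewrite ltn_eqF].
- move=> j; rewrite ltnS leq_eqVlt; case: (eqVneq j n) => [->|_] //= lt_jn.
  have [xj0|xj] := eqVneq (x j) 0; first by rewrite xj0 normr0 mulr0.
  by rewrite s'E; [exact: rho_sgn|exact: leq_ltn_trans (rho_lt j lt_jn xj)].
Qed.

(** In addition to the runs, a representative iota a in each run is chosen. *)
Lemma sign_runs (R : realType) (r : nat) (x : 'cV[R]_r) :
  exists (s p : nat) (rho : 'I_r -> nat) (iota : {ffun 'I_p -> 'I_r}),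
  [/\ forall j, x j 0 != 0 -> (rho j < p)%N,
      forall i j : 'I_r, (i <= j)%N -> x i 0 != 0 -> x j 0 != 0 ->
        (rho i <= rho j)%N,
      forall a, x (iota a) 0 != 0 /\ rho (iota a) = a &
      forall j, x j 0 = (-1) ^+ (s + rho j) * `|x j 0|].
Proof.
pose y j := if insub j is Some i then x i 0 else 0.
have yE (j : 'I_r) : y j = x j 0 by rewrite /y valK.
have [s [p [rho [rho_lt rho_mono rho_onto rho_sgn]]]] := nat_sign_runs y r.
have /fin_all_exists[iota iotaP] (a : 'I_p) :
    exists i : 'I_r, x i 0 != 0 /\ rho i = a.
  have [i lt_ir [yi rhoi]] := rho_onto a (ltn_ord a).
  by exists (Ordinal lt_ir); rewrite -yE.
exists s, p, (fun j => rho j), (finfun iota); split=> [j||a|j].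
- by rewrite -yE; exact: rho_lt.
- by move=> i j le_ij; rewrite -!yE; apply: rho_mono; rewrite le_ij /=.
- by rewrite ffunE.
- by rewrite -yE; exact: rho_sgn.
Qed.

(** * Sign non-reversal *)

(** The compression of B to one row and one weighted column per run of x turns
    a mixed-sign reversed vector into an alternating reversed one. *)
Lemma totally_nonpositive_sign_nonreversal (R : realType) (r : nat)
    (B : 'M[R]_r) :
  totally_nonpositive r B -> sign_nonreversal B (@mixed_sign R r).
Proof.
move=> B_le0 x [[i1 x_gt0] [i2 x_lt0]] _.
have [/existsP[i /andP[xi Bxi]]|no_i] :=
    boolP [exists i, (x i 0 != 0) && (0 <= x i 0 * (B *m x) i 0)].
  by exists i.
have {no_i} x_rev i : x i 0 != 0 -> x i 0 * (B *m x) i 0 < 0.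
  by move: no_i; rewrite negb_exists => /forallP/(_ i);
    rewrite negb_and ltNge => /orP[/negP|].
have [s [p [rho [iota [rho_lt rho_mono iotaP x_sgn]]]]] := sign_runs x.
have iota_incr : strictly_increasing iota.
  move=> a b lt_ab; rewrite ltnNge; apply/negP => le_ba.
  have [xa rhoa] := iotaP a; have [xb rhob] := iotaP b.
  by have := rho_mono _ _ le_ba xb xa; rewrite rhoa rhob leqNgt lt_ab.
have le_pr : (p <= r)%N.
  have := @leq_card _ _ iota; rewrite !card_ord; apply=> a b eq_ab.
  by apply: val_inj; rewrite /= -(iotaP a).2 -(iotaP b).2 eq_ab.
have p_ge2 : (2 <= p)%N.
  have x1 := rho_lt i1 (lt0r_neq0 x_gt0).
  have x2 := rho_lt i2 (ltr0_neq0 x_lt0).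
  rewrite ltnNge; apply/negP => p_le1; have eq_rho : rho i1 = rho i2 by lia.
  have : x i1 0 * x i2 0 = `|x i1 0| * `|x i2 0|.
    rewrite {1}[x i1 0]x_sgn {1}[x i2 0]x_sgn eq_rho mulrACA -expr2.
    by rewrite sqrr_sign mul1r.
  by move/eqP; rewrite lt_eqF // (@lt_le_trans _ _ 0) ?mulr_ge0 ?pmulr_rlt0.
(* The weights that merge each run of columns; they send e to x. *)
pose W : 'M[R]_(r, p) := \matrix_(j, a) if rho j == a then `|x j 0| else 0.
have W_supp j a : W j a != 0 -> x j 0 != 0 /\ rho j = a.
  by rewrite mxE; case: (rho j =P a) => [rhoE|_]; rewrite ?eqxx // normr_eq0.
pose e : 'cV[R]_p := \col_a (-1) ^+ (s + a).
have WeE : W *m e = x.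
  apply/matrixP => j c; rewrite (ord1 c) mxE [RHS]x_sgn.
  have [x0|xj] := eqVneq (x j 0) 0.
    rewrite x0 normr0 mulr0 big1 // => a _.
    by rewrite !mxE x0 normr0 if_same mul0r.
  rewrite (bigD1 (Ordinal (rho_lt j xj))) //= big1 => [|a a_neq].
    by rewrite !mxE eqxx addr0 mulrC.
  rewrite !mxE; case: eqP => [rhoE|_]; last by rewrite mul0r.
  by case/eqP: a_neq; apply: val_inj.
pose D := rowsub iota (B *m W).
have D_le0 : totally_nonpositive p D.
  have BW_le0 : totally_nonpositive r (B *m W).
    apply: totally_nonpositive_mul B_le0 => [j a|i j a b lt_ab].
      by rewrite mxE; case: ifP.
    move=> /W_supp[xi rhoi] /W_supp[xj rhoj]; rewrite ltnNge; apply/negP.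
    by move=> /rho_mono/(_ xj xi); rewrite rhoi rhoj leqNgt lt_ab.
  move=> c f g c_bnd f_incr g_incr.
  rewrite /D -mxsub_comp; have := BW_le0 c [ffun i => iota (f i)] g.
  rewrite mxsub_ffunl; apply=> //; first by lia.
  by move=> i j lt_ij; rewrite !ffunE; apply/iota_incr/f_incr.
apply: False_ind; apply: (@no_alternating_reversal _ _ D e) => // [|a].
  apply: alternatingI => a b; rewrite !mxE -!exprD.
  have -> : (a + b + (s + a + (s + b)) = (s + a + b).*2)%N.
    by rewrite -addnn; lia.
  by rewrite -mul2n exprM sqrrN !expr1n.
have [xa rhoa] := iotaP a.
have -> : (D *m e) a 0 = (B *m x) (iota a) 0.
  by rewrite /D mul_rowsub_mx -mulmxA WeE mxE.
have -> : e a 0 = (-1) ^+ (s + a) by rewrite mxE.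
have := x_rev _ xa; rewrite {1}[x (iota a) 0]x_sgn rhoa mulrAC.
by rewrite pmulr_llt0 ?normr_gt0.
Qed.

Theorem theorem5p4 (R : realType) (m n k : nat)
  (hk : (2 <= k)%N) (hm : (k <= m)%N) (hn : (k <= n)%N)
  (A : 'M[R]_(m, n)) (hA : forall i j, A i j <= 0)
  (alpha : forall r : nat,
    {ffun 'I_r -> 'I_m} -> {ffun 'I_r -> 'I_n} -> 'cV[R]_r)
  (halpha : forall (r : nat)
      (f : {ffun 'I_r -> 'I_m}) (g : {ffun 'I_r -> 'I_n}),
    (2 <= r <= k)%N -> strictly_increasing f -> strictly_increasing g ->
    @alternating R r (alpha r f g)) :
  [<-> totally_nonpositive k A;
       forall (r : nat) (f : {ffun 'I_r -> 'I_m}) (g : {ffun 'I_r -> 'I_n}),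
         (2 <= r <= k)%N -> strictly_increasing f -> strictly_increasing g ->
         sign_nonreversal (mxsub f g A) (@mixed_sign R r);
       forall (r : nat) (f : {ffun 'I_r -> 'I_m}) (g : {ffun 'I_r -> 'I_n}),
         (2 <= r <= k)%N -> strictly_increasing f -> strictly_increasing g ->
         sign_nonreversal (mxsub f g A) (@alternating R r);
       forall (r : nat) (f : {ffun 'I_r -> 'I_m}) (g : {ffun 'I_r -> 'I_n}),
         (2 <= r <= k)%N -> strictly_increasing f -> strictly_increasing g ->
         sign_nonreversal (mxsub f g A)
           [set (\adj (mxsub f g A) *m alpha r f g)]].
Proof.
tfae=> [A_le0 r f g r_bnd f_incr g_incr|nonrev r f g r_bnd f_incr g_incr|
  nonrev|nonrev].
- apply: totally_nonpositive_sign_nonreversal.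
  apply: totally_nonpositive_le (totally_nonpositive_mxsub f_incr g_incr A_le0).
  by case/andP: r_bnd.
- move=> x x_alt; apply: nonrev => //; apply: alternating_mixed_sign => //.
  by case/andP: r_bnd.
- have A_le0 : totally_nonpositive k A.
    apply: (totally_nonpositive_of_adj hA halpha) => r f g r_bnd f_incr g_incr.
    by move=> x x_alt x_neq0; exact: nonrev.
  move=> r f g r_bnd f_incr g_incr _ -> x_neq0.
  have /andP[r_ge2 r_le] := r_bnd.
  have minor_le0 := cofactor_minor_le0 r_ge2 (leqW r_le)
    (totally_nonpositive_mxsub f_incr g_incr A_le0).
  have alpha_alt := halpha r f g r_bnd f_incr g_incr.
  apply: (sign_nonreversal_adj minor_le0 alpha_alt _ x_neq0).
  by apply: A_le0 => //; rewrite (ltnW r_ge2).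
- apply: (totally_nonpositive_of_adj hA halpha) => r f g r_bnd f_incr g_incr.
  by move=> x _ x_neq0; exact: nonrev.
Qed.
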